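(* Let $F$ be a polybox in a $d$-box $X$ and let $\mathcal{F}$ be a proper suit for $F$. Suppose that $|\operatorname{ind}(F,C)|=|\mathcal{F}\cap\mathcal{C}_C|$ for every proper box $C$ of $X$. Then $\mathcal{F}$ is the only proper suit for $F$.
   Context: A $d$-box is $X=X_1\times\cdots\times X_d$ with finite nonempty sets $X_i$. A box is a nonempty $A=A_1\times\cdots\times A_d$ with $A_i\subseteq X_i$; it is proper if $A_i\neq X_i$ for all $i$. Boxes $A,B$ are dichotomous if $A_i=X_i\setminus B_i$ for some $i$. A suit is a family of pairwise dichotomous boxes, proper if it consists of proper boxes; a nonempty $F\subseteq X$ is a polybox if $F=\bigcup\mathcal{F}$ for some suit $\mathcal{F}$ (a suit for $F$). For a box $C$ and $\varepsilon\in\mathbb{Z}_2^d$, $C^\varepsilon=C_1^{\varepsilon_1}\times\cdots\times C_d^{\varepsilon_d}$ with $C_i^0=C_i$, $C_i^1=X_i\setminus C_i$; $\mathcal{C}_C=\{C^\varepsilon:\varepsilon\in\mathbb{Z}_2^d\}\setminus\{\emptyset\}$. For a box $C$ define $\varphi_C$ on proper boxes by $\varphi_C(A)=\prod_{i=1}^d\varphi_{C_i}(A_i)$, where $\varphi_{C_i}(A_i)=[A_i=C_i]-[A_i=X_i\setminus C_i]$ if $C_i\neq X_i$ and $\varphi_{C_i}\equiv 1$ if $C_i=X_i$ ($[\cdot]$ is the Iverson bracket). The index of a polybox $F$ relative to $C$ is $\operatorname{ind}(F,C)=\sum_{A\in\mathcal{G}}\varphi_C(A)$, where $\mathcal{G}$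 is any proper suit for $F$ (this does not depend on the choice of $\mathcal{G}$). *)

(* Defs.v *)
From mathcomp Require Import all_boot all_order all_algebra.

Set Implicit Arguments.
Unset Strict Implicit.
Unset Printing Implicit Defensive.

Local Open Scope ring_scope.

Section Polyboxes.

Variables (d : nat) (X : 'I_d -> finType).

Definition point := {dffun forall i : 'I_d, X i}.

(* A box is handled through its family of sides (A_1, ..., A_d), of which the
   box itself is the product; a nonempty product determines its sides. *)
Definition sides := {dffun forall i : 'I_d, {set X i}}.

Definition box_set (A : sides) : {set point} := setXn A.

Definition is_box (A : sides) : bool := box_set A != set0.

Definition proper_box (A : sides) : bool :=
  is_box A && [forall i, A i != [set: X i]].

Definition dichotomous (A B : sides) : bool := [exists i, A i == ~: B i].

Definition suit (S : {set sides}) : bool :=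
  [forall A in S, is_box A]
  && [forall A in S, forall B in S, (A != B) ==> dichotomous A B].

Definition suit_for (S : {set sides}) (F : {set point}) : bool :=
  suit S && (F == \bigcup_(A in S) box_set A).

Definition proper_suit_for (S : {set sides}) (F : {set point}) : bool :=
  suit_for S F && [forall A in S, proper_box A].

Definition polybox (F : {set point}) : bool :=
  (F != set0) && [exists S, suit_for S F].

Definition twist (C : sides) (e : {ffun 'I_d -> 'Z_2}) : sides :=
  [ffun i : 'I_d => (if e i == 0 then C i else ~: C i) : {set X i}].

Definition twists (C : sides) : {set sides} :=
  [set A in [set twist C e | e : {ffun 'I_d -> 'Z_2}] | is_box A].

Definition phi_side (T : finType) (C A : {set T}) : int :=
  if C == [set: T] then 1 else (A == C)%:R - (A == ~: C)%:R.

Definition phi (C A : sides) : int := \prod_(i < d) phi_side (C i) (A i).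

(* The sum is taken over some proper suit for F, its value being independent of
   the choice; the value 0 when F has no proper suit is a junk value. *)
Definition ind (F : {set point}) (C : sides) : int :=
  if [pick G | proper_suit_for G F] is Some G then \sum_(A in G) phi C A else 0.

End Polyboxes.

(* Main.v *)
Require Import Defs.
From mathcomp Require Import all_boot all_order all_algebra.

Set Implicit Arguments.
Unset Strict Implicit.
Unset Printing Implicit Defensive.

Import Order.TTheory GRing.Theory Num.Theory.

Local Open Scope ring_scope.

(** Call a predicate on the subsets of [X_i] a selector if it holds for exactly
    one set of each complementary pair; every point of [X_i] gives one. Moving
    from points to arbitrary selectors one coordinate at a time shows that
    whether some box of a proper suit for [F] is selected depends only on [F].
    As [A |-> [A = C] - [A = ~: C]] is a difference of two selectors, the sums
    over a proper suit of products of selectors and such differences also depend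
    only on [F]; in particular the index is well defined, and the hypothesis
    says that all boxes of [S] in a common class of twists have the same sign.

    Let [A] be a box of another proper suit [G], and suppose it is not in [S].
    Among the boxes of [S] not dichotomous to [A], take one, [B], differing from
    [A] in as many coordinates as possible, and fix a point of [A]. Use the
    signed function of [B_i] in the coordinates where [B] and [A] differ, and
    the point elsewhere. The resulting sum is [0] over [G]; over [S], only boxes
    that are twists of [B] contribute, all with the sign of [B], so it is
    positive. Hence [G] is contained in [S], and so equal to it. *)

(** * Selectors and the covering they induce on a suit *)

Section Selectors.

Variables (d : nat) (X : 'I_d -> finType).

Definition selector (T : finType) (c : pred {set T}) : Prop :=
  forall D, c (~: D) = ~~ c D.

Definition selects (c : forall i, pred {set X i}) (B : sides X) : bool :=
  [forall i, c i (B i)].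

(** For point selectors this says that the point lies in the union of the boxes. *)
Definition covered (S : {set sides X}) (c : forall i, pred {set X i}) : bool :=
  [exists B in S, selects c B].

Definition weight (S : {set sides X}) (f : forall i, {set X i} -> int) : int :=
  \sum_(B in S) \prod_(i < d) f i (B i).

Definition point_pred (T : finType) (x : T) : pred {set T} :=
  fun D => x \in D.

Lemma point_selector (T : finType) (x : T) : selector (point_pred x).
Proof. by move=> D; rewrite /point_pred inE. Qed.

Lemma box_setP (B : sides X) (p : point X) :
  reflect (forall i, p i \in B i) (p \in box_set B).
Proof. by rewrite /box_set; apply: (iffP setXnP). Qed.

Lemma proper_suit_forP (S : {set sides X}) (F : {set point X}) :
  proper_suit_for S F ->
  [/\ {in S &, forall A B, A != B -> dichotomous A B},
      {in S, forall (A : sides X) i, A i != [set: X i]},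
      {in S, forall A, exists p, p \in box_set A} &
      F = \bigcup_(A in S) box_set A].
Proof.
case/andP=> /andP[/andP[/forall_inP box_S /forall_inP dich_S] /eqP ->].
move=> /forall_inP prop_S; split=> //.
- by move=> A B SA SB; move/forall_inP: (dich_S A SA) => /(_ B SB)/implyP.
- by move=> A /prop_S /andP[_ /forallP].
- by move=> A /box_S /set0Pn.
Qed.

Lemma selects_dichotomous (c : forall i, pred {set X i}) (A B : sides X) :
    (forall i, selector (c i)) ->
  selects c A -> selects c B -> ~~ dichotomous A B.
Proof.
move=> sel_c /forallP cA /forallP cB; apply/existsP => -[i /eqP ABi].
by have := cA i; rewrite ABi sel_c cB.
Qed.

Definition at_point (c : forall i, pred {set X i}) j (x : X j) : forall i, pred {set X i} :=
  dfwith c (point_pred x).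

Arguments at_point c {j} x i.

Lemma at_point_selector (c : forall i, pred {set X i}) j (x : X j) i :
  (forall k, selector (c k)) -> selector (at_point c x i).
Proof.
move=> sel_c.
rewrite /at_point; case: (eqVneq j i) => [<-|ji]; last by rewrite dfwith_out.
by rewrite dfwith_in; apply: point_selector.
Qed.

Lemma selects_at_point (c : forall i, pred {set X i}) j (x : X j)
    (B : sides X) :
  selects (at_point c x) B =
    (x \in B j) && [forall i, (i != j) ==> c i (B i)].
Proof.
apply/forallP/andP => [cB | [xB /forall_inP cB] i].
  split; first by have := cB j; rewrite /at_point dfwith_in.
  by apply/forall_inP => i ij; have := cB i; rewrite /at_point dfwith_out // eq_sym.
case: (eqVneq j i) => [<-|ji]; first by rewrite /at_point dfwith_in.
by rewrite /at_point dfwith_out //; apply: cB; rewrite eq_sym.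
Qed.

Lemma selects_split (c : forall i, pred {set X i}) j (B : sides X) :
  selects c B = c j (B j) && [forall i, (i != j) ==> c i (B i)].
Proof.
apply/forallP/andP => [cB | [xB /forall_inP cB] i].
  by split=> //; apply/forall_inP => i _.
by case: (eqVneq i j) => [->|/cB].
Qed.

(* Boxes of a suit selected in all coordinates but [j] are complementary
   at [j]. *)
Lemma covered_complement (S : {set sides X}) (c : forall i, pred {set X i}) j
    (A : sides X) (x y : X j) :
    (forall i, selector (c i)) ->
    {in S &, forall A B, A != B -> dichotomous A B} ->
    A \in S -> selects (at_point c x) A -> covered S (at_point c y) ->
    y \notin A j ->
  exists2 B, B \in S & B j = ~: A j /\ [forall i, (i != j) ==> c i (B i)].
Proof.
move=> sel_c dich_S; rewrite selects_at_point => SA /andP[_ cA] /exists_inP[B SB].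
rewrite selects_at_point => /andP[yB cB] yA; exists B => //; split=> //.
have neBA: B != A by apply: contraNneq yA => <-.
have /existsP[i /eqP BAi] := dich_S _ _ SB SA neBA.
case: (eqVneq i j) => [ij|ij]; first by rewrite -ij.
have := forall_inP cB i ij.
by rewrite BAi sel_c (forall_inP cA).
Qed.

Lemma covered_step (S G : {set sides X}) (c : forall i, pred {set X i}) j :
    (forall i, selector (c i)) ->
    {in S &, forall A B, A != B -> dichotomous A B} ->
    {in G &, forall A B, A != B -> dichotomous A B} ->
    {in S, forall A : sides X, A j != set0} ->
    {in G, forall A : sides X, A j != [set: X j]} ->
    (forall x : X j, covered S (at_point c x) = covered G (at_point c x)) ->
  covered S c -> covered G c.
Proof.
move=> sel_c dS dG S0 GT eqSG /exists_inP[A SA].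
rewrite (selects_split c j) => /andP[cjA cA].
have /set0Pn[x xA] := S0 A SA.
have coverS y : y \in A j -> covered S (at_point c y).
  by move=> yA; apply/exists_inP; exists A => //; rewrite selects_at_point yA.
have := coverS x xA; rewrite eqSG => /exists_inP[B GB sB].
have := sB; rewrite selects_at_point => /andP[xB cB].
case cjB: (c j (B j)).
  by apply/exists_inP; exists B; rewrite // (selects_split c j) cjB.
(* A box of [G] with side [~: B j] is selected by [c j], which rejects [B j]. So a covered point
   outside [B j] suffices; the rest finds one. *)
have complB y : covered S (at_point c y) -> y \notin B j -> covered G c.
  rewrite eqSG => cGy yB.
  have [B' GB' [B'j cB']] := covered_complement sel_c dG GB sB cGy yB.
  apply/exists_inP; exists B' => //.
  by rewrite (selects_split c j) B'j sel_c cjB.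
have [sAB|/subsetPn[y yA yB]] := boolP (A j \subset B j); last first.
  exact: complB (coverS y yA) yB.
have [sBA|/subsetPn[y yB yA]] := boolP (B j \subset A j).
  by move: cjA; rewrite (_ : A j = B j) ?cjB //; apply/eqP; rewrite eqEsubset sAB.
have cSy : covered S (at_point c y).
  rewrite eqSG; apply/exists_inP; exists B => //.
  by rewrite selects_at_point yB.
(* Now [A j] lies strictly inside [B j]. A box of [S] with side [~: A j] then covers, together with
   [A], every point of [X j], in particular one outside the proper side [B j]. *)
have sA : selects (at_point c x) A by rewrite selects_at_point xA.
have [A' SA' [A'j cA']] := covered_complement sel_c dS SA sA cSy yA.
have [z zB] : exists z, z \notin B j.
  have := GT B GB; rewrite -subTset => /subsetPn[z _ zB]; by exists z.
apply: (complB z) => //; have [/coverS //|zA] := boolP (z \in A j).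
apply/exists_inP; exists A' => //.
by rewrite selects_at_point A'j inE zA.
Qed.

Lemma proper_suit_side_neq0 (S : {set sides X}) (F : {set point X}) j :
  proper_suit_for S F -> {in S, forall A : sides X, A j != set0}.
Proof.
move=> /proper_suit_forP[_ _ neS _] A /neS[p /box_setP pA].
by apply/set0Pn; exists (p j).
Qed.

Lemma covered_points (S : {set sides X}) (F : {set point X})
    (c : forall i, pred {set X i}) (p : forall i, X i) :
    F = \bigcup_(A in S) box_set A ->
    (forall i, c i =1 point_pred (p i)) ->
  covered S c = (([ffun i => p i] : point X) \in F).
Proof.
move=> -> cp; apply/exists_inP/bigcupP => -[B SB hB]; exists B => //.
  by apply/box_setP => i; rewrite ffunE; have := forallP hB i; rewrite cp.
by apply/forallP => i; rewrite cp; have := box_setP _ _ hB i; rewrite ffunE.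
Qed.

Lemma covered_invariant (S G : {set sides X}) (F : {set point X})
    (c : forall i, pred {set X i}) :
    proper_suit_for S F -> proper_suit_for G F ->
    (forall i, selector (c i)) ->
  covered S c = covered G c.
Proof.
move=> psS psG.
(* Induction on [k]: only the coordinates below [k] may carry selectors that are not points. *)
suff main k : forall c : forall i, pred {set X i},
    (forall i, selector (c i)) ->
    (forall i : 'I_d, (k <= i)%N -> exists x, c i =1 point_pred x) ->
    covered S c = covered G c.
  by move=> sel_c; apply: (main d) => // i; rewrite leqNgt ltn_ord.
have [dS TS _ FS] := proper_suit_forP psS.
have [dG TG _ FG] := proper_suit_forP psG.
elim: k => [|k IHk] {}c sel_c pt_c.
  have /fin_all_exists[p cp] i : exists x, c i =1 point_pred x by apply: pt_c.
  by rewrite (covered_points FS cp) (covered_points FG cp).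
have [ltkd|ledk] := ltnP k d; last first.
  by apply: IHk => // i /(leq_trans ledk); rewrite leqNgt ltn_ord.
pose j := Ordinal ltkd.
have eqSG (x : X j) : covered S (at_point c x) = covered G (at_point c x).
  apply: IHk => [i|i leki]; first exact: at_point_selector.
  rewrite /at_point; case: (eqVneq j i) => [<-|ji].
    by exists x; rewrite dfwith_in.
  by rewrite dfwith_out //; apply: pt_c; rewrite ltn_neqAle leki andbT.
apply/idP/idP; apply: (@covered_step _ _ _ j) => //.
- exact: proper_suit_side_neq0 psS.
- by move=> A /TG.
- exact: proper_suit_side_neq0 psG.
- by move=> A /TS.
Qed.

(** * Sums of products over a suit *)

Lemma weight_selector (S : {set sides X}) (c : forall i, pred {set X i}) :
    {in S &, forall A B, A != B -> dichotomous A B} ->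
    (forall i, selector (c i)) ->
  weight S (fun i D => (c i D)%:R) = (covered S c)%:R.
Proof.
move=> dS sel_c; rewrite /weight.
have prodE (B : sides X) : \prod_(i < d) (c i (B i))%:R = (selects c B)%:R :> int.
  case: (boolP (selects c B)) => [/forallP cB|/forallPn[i /negbTE cBi]].
    by apply: big1 => i _; rewrite cB.
  by rewrite (bigD1 i) //= cBi mul0r.
under eq_bigr do rewrite prodE.
(* Dichotomous boxes cannot both be selected, so at most one term is nonzero. *)
case: (boolP (covered S c)) => [/exists_inP[A SA cA]|/exists_inPn ncov].
  rewrite (bigD1 A) //= cA big1 ?addr0 // => B /andP[SB neBA].
  have [cB|//] := boolP (selects c B).
  by have := selects_dichotomous sel_c cB cA; rewrite dS.
by apply: big1 => B /ncov /negbTE ->.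
Qed.

Definition selector_fun (T : finType) (h : {set T} -> int) : Prop :=
  exists2 c, selector c & forall D, h D = (c D)%:R.

Definition selector_difference (T : finType) (h : {set T} -> int) : Prop :=
  exists c c', [/\ selector c, selector c' &
                   forall D, h D = (c D)%:R - (c' D)%:R].

Lemma eq_weight (S : {set sides X}) (f g : forall i, {set X i} -> int) :
  (forall i, f i =1 g i) -> weight S f = weight S g.
Proof.
by move=> fg; apply: eq_bigr => B _; apply: eq_bigr => i _; rewrite fg.
Qed.

(** Each product is linear in its factor at [j]. *)
Lemma weight_difference (S : {set sides X}) (f : forall i, {set X i} -> int)
    j (g h : {set X j} -> int) :
    (forall D, f j D = g D - h D) ->
  weight S f = weight S (dfwith f g) - weight S (dfwith f h).
Proof.
move=> fE; rewrite /weight -sumrB; apply: eq_bigr => B _.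
have prodE k : \prod_(i < d) dfwith f k i (B i) =
    k (B j) * \prod_(i < d | i != j) f i (B i).
  rewrite (bigD1 j) //= dfwith_in; congr (_ * _); apply: eq_bigr => i ij.
  by rewrite dfwith_out // eq_sym.
by rewrite !prodE (bigD1 j) //= fE mulrBl.
Qed.

Lemma weight_invariant (S G : {set sides X}) (F : {set point X})
    (f : forall i, {set X i} -> int) :
    proper_suit_for S F -> proper_suit_for G F ->
    (forall i, selector_fun (f i) \/ selector_difference (f i)) ->
  weight S f = weight G f.
Proof.
move=> psS psG.
(* Induction on [k]: only the coordinates below [k] may carry differences. A difference at
   coordinate [k] splits by linearity into two plain selectors. *)
suff main k : forall f : forall i, {set X i} -> int,
    (forall i, selector_fun (f i) \/ selector_difference (f i)) ->
    (forall i : 'I_d, (k <= i)%N -> selector_fun (f i)) ->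
    weight S f = weight G f.
  by move=> sel_f; apply: (main d) => // i; rewrite leqNgt ltn_ord.
have [dS _ _ _] := proper_suit_forP psS.
have [dG _ _ _] := proper_suit_forP psG.
elim: k => [|k IHk] {}f sel_f fun_f.
  have /fin_all_exists[c cP] i :
      exists c, selector c /\ forall D, f i D = (c D)%:R.
    by have [//|c sel_c fE] := fun_f i; exists c.
  rewrite !(@eq_weight _ f (fun i D => (c i D)%:R)) => [|i D|i D];
    try by rewrite (cP i).2.
  have sel_c i : selector (c i) by have [] := cP i.
  by rewrite !weight_selector // (covered_invariant psS psG).
have [ltkd|ledk] := ltnP k d; last first.
  by apply: IHk => // i /(leq_trans ledk); rewrite leqNgt ltn_ord.
pose j := Ordinal ltkd.
have above i : j != i -> (k <= i)%N -> (k < i)%N.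
  by move=> ji leki; rewrite ltn_neqAle leki andbT.
have [fun_j|[c [c' [sel_c sel_c' fE]]]] := sel_f j.
  apply: IHk => // i leki; case: (eqVneq j i) => [<- //|ji].
  exact/fun_f/above.
have step (g : pred {set X j}) : selector g ->
    weight S (dfwith f (fun D => (g D)%:R)) =
    weight G (dfwith f (fun D => (g D)%:R)).
  move=> sel_g; apply: IHk => i.
    case: (eqVneq j i) => [<-|ji]; last by rewrite dfwith_out.
    by left; rewrite dfwith_in; exists g.
  move=> leki; case: (eqVneq j i) => [<-|ji].
    by rewrite dfwith_in; exists g.
  by rewrite dfwith_out //; apply/fun_f/above.
by rewrite !(weight_difference _ fE) !step.
Qed.

End Selectors.

(** This is [phi_side] without its exceptional value for the full set, hence a difference of
    selectors for every [C] when [T] has a point. *)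
Definition sign_side (T : finType) (C A : {set T}) : int :=
  (A == C)%:R - (A == ~: C)%:R.

(** The point [x] excludes the empty type, whose only subset is its own complement. *)
Lemma neq_setC (T : finType) (x : T) (C : {set T}) : C != ~: C.
Proof. by apply/eqP => /setP/(_ x); rewrite inE; case: (x \in C). Qed.

Lemma sign_side_id (T : finType) (x : T) (C : {set T}) : sign_side C C = 1.
Proof. by rewrite /sign_side eqxx (negbTE (neq_setC x C)). Qed.

Lemma sign_side_neq0 (T : finType) (C A : {set T}) :
  sign_side C A != 0 -> A = C \/ A = ~: C.
Proof.
rewrite /sign_side; have [->|_] := eqVneq A C; first by left.
by have [->|//] := eqVneq A (~: C); right.
Qed.

(* The two selectors agree with a point except that they swap [C] and its
   complement. *)
Lemma sign_side_difference (T : finType) (x : T) (C : {set T}) :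
  selector_difference (sign_side C).
Proof.
have neC := neq_setC x C.
have eqC D : (~: D == C) = (D == ~: C) by rewrite -(inj_eq (@setC_inj _)) setCK.
have eqCC D : (~: D == ~: C) = (D == C) by rewrite (inj_eq (@setC_inj _)).
exists (fun D => (D == C) || (D != ~: C) && (x \in D)).
exists (fun D => (D == ~: C) || (D != C) && (x \in D)).
split=> D; rewrite ?eqC ?eqCC ?inE ?/sign_side.
- by case: (eqVneq D C) => [->|_] /=; rewrite ?(negbTE neC) //; case: eqP.
- by case: (eqVneq D C) => [->|_] /=; rewrite ?(negbTE neC) //; case: eqP.
- case: (eqVneq D C) => [->|_] /=; rewrite ?(negbTE neC) //.
  by case: eqP; case: (x \in D).
Qed.

(** * The index and the signs of twists *)

Section Signs.

Variables (d : nat) (X : 'I_d -> finType).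
Implicit Types (A B C : sides X) (S G : {set sides X}) (F : {set point X}).

Lemma phi_sign C A :
  proper_box C -> phi C A = \prod_(i < d) sign_side (C i) (A i).
Proof.
case/andP=> _ /forallP propC; apply: eq_bigr => i _.
by rewrite /phi_side (negbTE (propC i)).
Qed.

Lemma ind_phi S F C (p : forall i, X i) :
    proper_suit_for S F -> proper_box C ->
  ind F C = \sum_(A in S) phi C A.
Proof.
move=> psS propC; rewrite /ind; case: pickP => [G psG|/(_ S)]; last by rewrite psS.
under eq_bigr do rewrite phi_sign //.
under [RHS]eq_bigr do rewrite phi_sign //.
apply: (weight_invariant (f := fun i => sign_side (C i)) psG psS) => i; right.
exact: sign_side_difference (p i) _.
Qed.

(** Every factor is at most 1 in absolute value, and if none vanishes, each side of [A] is that of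
    [C] or its complement. *)
Lemma norm_phi_twists C A :
  proper_box C -> is_box A -> `|phi C A| <= (A \in twists C)%:R.
Proof.
move=> propC boxA; rewrite phi_sign // normr_prod.
have [notw|] := boolP [forall i, sign_side (C i) (A i) != 0]; last first.
  by case/forallPn=> i /negPn/eqP Ci0; rewrite (bigD1 i) //= Ci0 normr0 mul0r.
have -> : A \in twists C.
  rewrite inE boxA andbT; apply/imsetP.
  exists [ffun i => if A i == C i then 0 else 1] => //; apply/ffunP => i.
  rewrite !ffunE; have [-> //|/eqP neAC] /= := eqVneq (A i) (C i).
  by have [] := sign_side_neq0 (forallP notw i).
apply: prodr_ile1 => i _; rewrite normr_ge0 /sign_side.
by case: (_ == _); case: (_ == _).
Qed.

Lemma phi_id C (p : forall i, X i) : proper_box C -> phi C C = 1.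
Proof.
by move=> propC; rewrite phi_sign //; apply: big1 => i _; rewrite (sign_side_id (p i)).
Qed.

(** The hypothesis forces equality in the triangle inequality, so all nonzero terms have one sign,
    which is that of [phi C C = 1]. *)
Lemma phi_ge0 S C (p : forall i, X i) :
    proper_box C -> {in S, forall A, is_box A} -> C \in S ->
    `|\sum_(A in S) phi C A| = #|S :&: twists C|%:Z ->
  {in S, forall A, 0 <= phi C A}.
Proof.
move=> propC boxS SC.
have -> : #|S :&: twists C|%:Z = \sum_(A in S) (A \in twists C)%:R :> int.
  rewrite -natz -sum1_card natr_sum big_mkcond [RHS]big_mkcond /=.
  by apply: eq_bigr => A _; rewrite inE; case: (A \in S); case: (A \in twists C).
move=> normE.
have le_norm : \sum_(A in S) `|phi C A| <= `|\sum_(A in S) phi C A|.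
  by rewrite normE; apply: ler_sum => A /boxS; apply: norm_phi_twists.
have [sum_ge0|sum_lt0] := leP 0 (\sum_(A in S) phi C A).
  rewrite ger0_norm // -subr_le0 -sumrB in le_norm.
  have term_ge0 A : A \in S -> 0 <= `|phi C A| - phi C A.
    by rewrite subr_ge0 ler_norm.
  have /eqP := le_anti (introT andP (conj le_norm (sumr_ge0 _ term_ge0))).
  rewrite psumr_eq0 // => /allP eq0 A SA.
  have := eq0 A (mem_index_enum _); rewrite SA subr_eq0 => /eqP <-.
  exact: normr_ge0.
rewrite ltr0_norm // -subr_le0 opprK -big_split /= in le_norm.
have term_ge0 A : A \in S -> 0 <= `|phi C A| + phi C A.
  by move=> _; rewrite -lerBlDr sub0r -normrN ler_norm.
have /eqP := le_anti (introT andP (conj le_norm (sumr_ge0 _ term_ge0))).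
rewrite psumr_eq0 // => /allP eq0.
by have := eq0 C (mem_index_enum _); rewrite SC (phi_id p).
Qed.

Lemma box_inter_nondichotomous A B (x : point X) :
  x \in box_set A -> x \in box_set B -> ~~ dichotomous A B.
Proof.
move=> /box_setP xA /box_setP xB; apply/existsP => -[i /eqP ABi].
by have := xA i; rewrite ABi inE xB.
Qed.

(** * Comparison of two proper suits *)

Lemma suit_box_mem S G F A (p : forall i, X i) :
    proper_suit_for S F -> proper_suit_for G F ->
    (forall C, proper_box C -> `|ind F C| = #|S :&: twists C|%:Z) ->
  A \in G -> A \in S.
Proof.
move=> psS psG indF GA; apply: contraT => notSA.
have [dS TS neS FS] := proper_suit_forP psS.
have [dG TG neG FG] := proper_suit_forP psG.
have [x xA] := neG A GA.
have /bigcupP[B1 SB1 xB1] : x \in \bigcup_(B in S) box_set B.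
  by rewrite -FS FG; apply/bigcupP; exists A.
pose near B := (B \in S) && ~~ dichotomous A B.
have near1 : near B1 by rewrite /near SB1 (box_inter_nondichotomous xA xB1).
pose diff B := [set i | B i != A i].
case: (@arg_maxnP _ B1 near (fun B => #|diff B|) near1) => B /andP[SB nAB] maxB.
have /= nABi i : A i != ~: B i by move: nAB => /existsPn/(_ i).
have boxS : {in S, forall C, is_box C}.
  by move=> C /neS[y yC]; apply/set0Pn; exists y.
have propB : proper_box B by rewrite /proper_box boxS //; apply/forallP => i; apply: TS.
have phiB_ge0 : {in S, forall C, 0 <= phi B C}.
  apply: phi_ge0 => //; rewrite -(ind_phi p psS) //; exact: indF.
pose f i (D : {set X i}) : int :=
  if B i == A i then (x i \in D)%:R else sign_side (B i) D.
have weightSG : weight S f = weight G f.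
  apply: (weight_invariant psS psG) => i; rewrite /f.
  case: (B i == A i); last by right; exact: sign_side_difference (p i) _.
  by left; exists (point_pred (x i)) => //; exact: point_selector.
have sign0 i : B i != A i -> sign_side (B i) (A i) = 0.
  rewrite eq_sym => neq.
  by rewrite /sign_side (negbTE neq) (negbTE (nABi i)) subr0.
have sign0C i : B i != A i -> sign_side (B i) (~: A i) = 0.
  move=> neq; rewrite /sign_side (inj_eq (@setC_inj _)) eq_sym.
  by rewrite -(inj_eq (@setC_inj _)) setCK eq_sym (negbTE (nABi i))
             eq_sym (negbTE neq) subr0.
(* [A] is killed at a coordinate where it differs from [B]. Any other box of [G] has a side
   [~: A i], which misses [x i] or has sign 0. *)
have weightG0 : weight G f = 0.
  apply: big1 => C GC; have [->|neCA] := eqVneq C A.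
    have /existsP[i neBA] : [exists i, B i != A i].
      rewrite -negb_forall; apply: contraNN notSA => /forallP eqBA.
      by rewrite (_ : A = B) //; apply/ffunP => i; rewrite (eqP (eqBA i)).
    by rewrite (bigD1 i) //= /f (negbTE neBA) sign0 // mul0r.
  have /existsP[i /eqP CAi] := dG _ _ GC GA neCA.
  rewrite (bigD1 i) //= /f CAi; case: eqVneq => [_|neBA].
    by rewrite inE (box_setP _ _ xA) mul0r.
  by rewrite sign0C // mul0r.
have termE C : C \in S ->
    \prod_(i < d) f i (C i) = 0 \/ \prod_(i < d) f i (C i) = phi B C.
  move=> SC; have [->|] := eqVneq (\prod_(i < d) f i (C i)) 0; first by left.
  move=> /prodf_neq0 nz; right.
  have neqC i : C i != ~: A i /\ (B i != A i -> C i != A i).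
    have := nz i isT; rewrite /f; case: (eqVneq (B i) (A i)) => [_|neBA] /= nzi.
      split=> //; apply: contraNneq nzi => ->.
      by rewrite inE (box_setP _ _ xA).
    by split=> [|_]; apply: contraNneq nzi => ->; rewrite ?sign0 ?sign0C.
  (* A nonzero term comes from a box not dichotomous to [A] that differs from [A] wherever [B] does.
     Maximality of [B] makes the two sets of coordinates equal, so [C] agrees with [A] and [B]
     elsewhere. *)
  have nearC : near C.
    rewrite /near SC; apply/existsPn => i; apply: contraNneq (neqC i).1 => ->.
    by rewrite setCK.
  have sub : diff B \subset diff C.
    by apply/subsetP => i; rewrite !inE; apply: (neqC i).2.
  have /eqP eqBC : diff B == diff C by rewrite eqEcard sub; apply: maxB.
  rewrite phi_sign //; apply: eq_bigr => i _; rewrite /f.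
  case: eqVneq => // BA; have /setP/(_ i) := eqBC.
  rewrite !inE BA eqxx => /esym/negbFE/eqP ->.
  by rewrite (sign_side_id (p i)) (box_setP _ _ xA).
have termB : \prod_(i < d) f i (B i) = 1.
  apply: big1 => i _; rewrite /f; case: eqVneq => [->|_].
    by rewrite (box_setP _ _ xA).
  exact: sign_side_id (p i) _.
have : 0 < weight S f.
  rewrite /weight (bigD1 B) //= termB ltr_pwDl // sumr_ge0 // => C /andP[SC _].
  by have [->|->] := termE C SC; rewrite ?phiB_ge0.
by rewrite weightSG weightG0 ltxx.
Qed.

End Signs.

Theorem theorem8p2 (d : nat) (X : 'I_d -> finType)
    (X_nonempty : forall i : 'I_d, (0 < #|X i|)%N)
    (F : {set point X}) (S : {set sides X})
    (polyboxF : polybox F) (suitS : proper_suit_for S F)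
    (indF : forall C : sides X, proper_box C ->
      `|ind F C| = #|S :&: twists C|%:Z) :
  forall G : {set sides X}, proper_suit_for G F -> G = S.
Proof.
move=> G suitG.
have /fin_all_exists[p _] i : exists x : X i, true.
  by have /card_gt0P[x _] := X_nonempty i; exists x.
have GS A : A \in G -> A \in S by apply: (suit_box_mem p suitS suitG indF).
have [dS _ neS FS] := proper_suit_forP suitS.
have [_ _ _ FG] := proper_suit_forP suitG.
(* Conversely, a box of [S] shares a point with a box of [G], which also lies in [S]; distinct boxes
   of a suit are disjoint. *)
apply/setP => B; apply/idP/idP => [/GS //|SB].
have [x xB] := neS B SB.
have /bigcupP[A GA xA] : x \in \bigcup_(A in G) box_set A.
  by rewrite -FG FS; apply/bigcupP; exists B.
have [<- //|neAB] := eqVneq A B.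
by have := box_inter_nondichotomous xA xB; rewrite dS // GS.
Qed.
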